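(* Let $I,J\subset\mathbb{R}$ be open intervals and let $u:I\to\mathbb{R}$, $v:J\to\mathbb{R}$ be smooth functions. Consider the translation surface of type 1 in the Heisenberg group $\mathrm{Nil}_3$, parametrized by $$r(x,y)=(x,0,u(x))*(0,y,v(y))=\Big(x,\,y,\,u(x)+v(y)+\frac{xy}{2}\Big),\qquad (x,y)\in I\times J.$$ This surface is minimal if and only if there exist constants $a,c,u_0,v_0\in\mathbb{R}$ such that $$u(x)=ax+u_0\quad\text{for all }x\in I,$$ $$v(y)=c\left[(a+y)\sqrt{1+(a+y)^2}+\ln\left(a+y+\sqrt{1+(a+y)^2}\right)\right]+v_0\quad\text{for all }y\in J.$$
   Context: The Heisenberg group $\mathrm{Nil}_3$ is $\mathbb{R}^3$ with the group operation $$(x,y,z)*(\overline{x},\overline{y},\overline{z})=\Big(x+\overline{x},\ y+\overline{y},\ z+\overline{z}+\frac{x\overline{y}}{2}-\frac{\overline{x}y}{2}\Big),$$ equipped with the left invariant Riemannian metric $$\tilde g=dx^2+dy^2+\Big(dz+\tfrac12(y\,dx-x\,dy)\Big)^2.$$ A translation surface $M(\gamma_1,\gamma_2)$ in $\mathrm{Nil}_3$ is a surface parametrized by $r(x,y)=\gamma_1(x)*\gamma_2(y)$, where $\gamma_1,\gamma_2$ are curves lying in coordinate planes of $\mathbb{R}^3$. It is of type 1 when $\gamma_1(x)=(x,0,u(x))$ and $\gamma_2(y)=(0,y,v(y))$ with $u,v$ smooth. A surface immersed in $(\mathrm{Nil}_3,\tilde g)$ is minimal if its mean curvature $H=\frac12\mathrm{trace}(A)$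 vanishes identically, where $A$ is the shape operator with respect to a unit normal and the metric $\tilde g$. *)

(* Defs.v *)
From HB Require Import structures.
From mathcomp Require Import all_boot all_order all_algebra.
From mathcomp Require Import all_classical all_reals all_analysis.
Set Implicit Arguments.
Unset Strict Implicit.
Unset Printing Implicit Defensive.
Import Order.TTheory GRing.Theory Num.Theory.
Import numFieldNormedType.Exports.
Local Open Scope classical_set_scope.
Local Open Scope ring_scope.

Definition smooth_on (R : realType) (I : set R) (u : R -> R) : Prop :=
  forall (n : nat) (x : R), I x -> derivable (derive1n n u) x 1.

Definition vec3 (R : realType) (x y z : R) : 'rV[R]_3 :=
  \row_(k < 3) [:: x; y; z]`_k.

(* A Riemannian metric on R^3 is given by its Gram matrix [g p] in the
   coordinate frame at [p]; tangent vectors are row vectors. *)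
Section SurfacesInR3.
Variables (R : realType) (g : 'rV[R]_3 -> 'M[R]_3).

Definition inner (p v w : 'rV[R]_3) : R := (v *m g p *m w^T) 0 0.

(* The Christoffel symbol Gamma^k_ij of the Levi-Civita connection. *)
Definition christoffel (k i j : 'I_3) (p : 'rV[R]_3) : R :=
  2^-1 * \sum_(l < 3) invmx (g p) k l *
    ('D_(delta_mx 0 i) (fun q => g q j l) p
     + 'D_(delta_mx 0 j) (fun q => g q i l) p
     - 'D_(delta_mx 0 l) (fun q => g q i j) p).

(* A surface is parametrized by [r] on a subset [D] of R^2.  The rows of
   [jacobian r p] are the two partial derivatives of [r]; they span the
   tangent plane. *)
Variables (r : 'rV[R]_2 -> 'rV[R]_3) (D : set 'rV[R]_2).

Definition immersion_on : Prop :=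
  forall p, D p -> differentiable r p /\ row_free (jacobian r p).

Definition unit_normal_on (N : 'rV[R]_2 -> 'rV[R]_3) : Prop :=
  forall p, D p ->
    [/\ differentiable N p,
        forall i : 'I_2, inner (r p) (N p) (row i (jacobian r p)) = 0
      & inner (r p) (N p) (N p) = 1].

(* Row [i] is the Levi-Civita derivative of the vector field [V] along [r] in
   the direction of the [i]-th partial derivative of [r]. *)
Definition cov_derivative (V : 'rV[R]_2 -> 'rV[R]_3) (p : 'rV[R]_2)
    : 'M[R]_(2, 3) :=
  \matrix_(i < 2, k < 3) (jacobian V p i k +
    \sum_(a < 3) \sum_(b < 3)
      christoffel k a b (r p) * jacobian r p i a * V p 0 b).

(* The matrix, in the frame of partial derivatives of [r], of the shape operator
   A(X) = - nabla_X N: its row [i] holds the coordinates in that frame of the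
   image of the [i]-th frame vector ([pinvmx] solves S *m jacobian r p =
   - cov_derivative N p, which is possible because nabla_X N is tangent). *)
Definition shape_operator (N : 'rV[R]_2 -> 'rV[R]_3) (p : 'rV[R]_2)
    : 'M[R]_2 :=
  - cov_derivative N p *m pinvmx (jacobian r p).

Definition mean_curvature (N : 'rV[R]_2 -> 'rV[R]_3) (p : 'rV[R]_2) : R :=
  2^-1 * \tr (shape_operator N p).

Definition minimal_surface : Prop :=
  immersion_on /\
  exists2 N, unit_normal_on N & forall p, D p -> mean_curvature N p = 0.

End SurfacesInR3.

Section Nil3.
Variable R : realType.

Definition nil_op (p q : 'rV[R]_3) : 'rV[R]_3 :=
  let: (x, y, z) := (p 0 0, p 0 1, p 0 2) in
  let: (x', y', z') := (q 0 0, q 0 1, q 0 2) in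
  vec3 (x + x') (y + y') (z + z' + x * y' / 2 - x' * y / 2).

(* Row vectors also represent 1-forms; the square of the 1-form [w] has Gram
   matrix [w^T *m w]. *)
Definition nil_metric (p : 'rV[R]_3) : 'M[R]_3 :=
  let dx : 'rV[R]_3 := delta_mx 0 0 in
  let dy : 'rV[R]_3 := delta_mx 0 1 in
  let dz : 'rV[R]_3 := delta_mx 0 2 in
  let w := dz + 2^-1 *: (p 0 1 *: dx - p 0 0 *: dy) in
  dx^T *m dx + dy^T *m dy + w^T *m w.

Definition translation_surface (gamma1 gamma2 : R -> 'rV[R]_3)
    (p : 'rV[R]_2) : 'rV[R]_3 :=
  nil_op (gamma1 (p 0 0)) (gamma2 (p 0 1)).

Definition translation_surface1 (u v : R -> R) : 'rV[R]_2 -> 'rV[R]_3 :=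
  translation_surface (fun x => vec3 x 0 (u x)) (fun y => vec3 0 y (v y)).

Definition rectangle (I J : set R) : set 'rV[R]_2 :=
  [set p | I (p 0 0) /\ J (p 0 1)].

End Nil3.

(* Main.v *)
(* In the left-invariant frame e1, e2, e3 the surface has tangent vectors
   e1 + p e3 and e2 + q e3 with p = u'(x) + y and q = v'(y), so a unit normal N
   has frame components c (-p, -q, 1) with c^2 (1 + p^2 + q^2) = 1.
   Differentiating these relations and inserting them into the Levi-Civita
   derivative of N shows that the mean curvature is a nonvanishing multiple of
     (1 + q^2) u'' - p q + (1 + p^2) v''.
   If u' took two values it would take a third one halfway between them; the
   three equations so obtained force v' = v'' = 0 and then u'' = 0.  So u' is a
   constant a, and the remaining equation (1 + (a + y)^2) v'' = (a + y) v' makes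
   v' a multiple of sqrt (1 + (a + y)^2). *)
Require Import Defs.
From HB Require Import structures.
From mathcomp Require Import all_boot all_order all_algebra.
From mathcomp Require Import all_classical all_reals all_analysis.
From mathcomp Require Import ring lra.
Set Implicit Arguments.
Unset Strict Implicit.
Unset Printing Implicit Defensive.
Import Order.TTheory GRing.Theory Num.Theory.
Import numFieldNormedType.Exports.
Local Open Scope classical_set_scope.
Local Open Scope ring_scope.

(** * Case analysis and sums over the index types with two and three elements *)

Lemma ord3P (i : 'I_3) : [\/ i = 0, i = 1 | i = 2].
Proof.
by case: i => [[|[|[|//]]] ?]; [apply: Or31|apply: Or32|apply: Or33];
  exact/val_inj.
Qed.

Lemma ord2P (i : 'I_2) : i = 0 \/ i = 1.
Proof. by case: i => [[|[|//]] ?]; [left|right]; exact/val_inj. Qed.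

Lemma big_ord3 (V : nmodType) (F : 'I_3 -> V) :
  \sum_(i < 3) F i = F 0 + F 1 + F 2.
Proof.
rewrite !big_ord_recl big_ord0 addr0 addrA.
by congr (F _ + F _ + F _); exact/val_inj.
Qed.

Lemma big_ord2 (V : nmodType) (F : 'I_2 -> V) :
  \sum_(i < 2) F i = F 0 + F 1.
Proof.
rewrite !big_ord_recl big_ord0 addr0.
by congr (F _ + F _); exact/val_inj.
Qed.

(** * The metric of the Heisenberg group, its inverse and its Christoffel symbols *)

Section Vec3.
Variable R : realType.

Lemma vec3_0 (x y z : R) i : vec3 x y z i 0 = x.
Proof. by rewrite mxE. Qed.

Lemma vec3_1 (x y z : R) i : vec3 x y z i 1 = y.
Proof. by rewrite mxE. Qed.

Lemma vec3_2 (x y z : R) i : vec3 x y z i 2 = z.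
Proof. by rewrite mxE. Qed.

Definition vec3E := (vec3_0, vec3_1, vec3_2).

(* The components of the contact form [dz + (y dx - x dy) / 2]. *)
Definition contact (p : 'rV[R]_3) : 'rV[R]_3 := vec3 (p 0 1 / 2) (- p 0 0 / 2) 1.

Lemma nil_metricE p i j : nil_metric p i j =
  ((i == 0) && (j == 0))%:R + ((i == 1) && (j == 1))%:R
  + contact p 0 i * contact p 0 j.
Proof.
rewrite /nil_metric !mxE !big_ord1 !mxE.
by have [] := ord3P i; have [] := ord3P j => -> ->; rewrite ?vec3E /=; field.
Qed.

(** Here [e1], [e2], [e3] is the left-invariant orthonormal frame, dual to dx, dy and the contact
    form. The squares of the dual frame sum to the metric, so those of the frame sum to its
    inverse. *)
Definition nil_cometric (p : 'rV[R]_3) : 'M[R]_3 :=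
  let e1 := vec3 1 0 (- p 0 1 / 2) in
  let e2 := vec3 0 1 (p 0 0 / 2) in
  let e3 := vec3 0 0 1 in
  e1^T *m e1 + e2^T *m e2 + e3^T *m e3.

Lemma invmx_nil_metric p : invmx (nil_metric p) = nil_cometric p.
Proof.
have E : nil_metric p *m nil_cometric p = 1%:M.
  apply/matrixP => i j; rewrite !mxE big_ord3 !nil_metricE !mxE !big_ord1 !mxE.
  by have [] := ord3P i; have [] := ord3P j => -> ->; rewrite ?vec3E /=; field.
have [gu _] := mulmx1_unit E.
by rewrite -[LHS]mulmx1 -E mulmxA mulVmx// mul1mx.
Qed.

Lemma is_derive_coord n (p v : 'rV[R]_n.+1) j :
  is_derive p v (fun q : 'rV[R]_n.+1 => q 0 j) (v 0 j).
Proof.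
have did : derivable (@id 'rV[R]_n.+1) p v by exact: derivable_id.
split; first exact: ((derivable_mxP _ _ _).1 did 0 j).
by have := derive_mx did; rewrite derive_id => /matrixP/(_ 0 j); rewrite mxE.
Qed.

(** The partial derivative in direction [k] of the coefficient [i] of the contact form; it is
    constant because the coefficients are affine, and antisymmetric in [k] and [i]. *)
Definition dcontact (k i : 'I_3) : R :=
  ((k == 1) && (i == 0))%:R / 2 - ((k == 0) && (i == 1))%:R / 2.

Lemma is_derive_contact (p : 'rV[R]_3) k i :
  is_derive p (delta_mx 0 k) (fun q => contact q 0 i) (dcontact k i).
Proof.
have d0 := @is_derive_coord _ p (delta_mx 0 k) 0.
have d1 := @is_derive_coord _ p (delta_mx 0 k) 1.
have [] := ord3P i => ->.
- under eq_fun do rewrite vec3_0.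
  apply: is_derive_eq; rewrite /dcontact !mxE /GRing.scale /= mulr0 add0r.
  by have [] := ord3P k => -> /=; field.
- under eq_fun do rewrite vec3_1.
  apply: is_derive_eq; rewrite /dcontact !mxE /GRing.scale /= mulr0 add0r.
  by have [] := ord3P k => -> /=; field.
- under eq_fun do rewrite vec3_2.
  apply: is_derive_eq; rewrite /dcontact.
  by have [] := ord3P k => -> /=; rewrite mul0r subr0.
Qed.

Lemma derive_nil_metric (p : 'rV[R]_3) k i j :
  'D_(delta_mx 0 k) (fun q => nil_metric q i j) p =
  contact p 0 i * dcontact k j + contact p 0 j * dcontact k i.
Proof.
under eq_fun do rewrite nil_metricE.
have di := is_derive_contact p k i.
have dj := is_derive_contact p k j.
by rewrite derive_val add0r.
Qed.

(* [nil_rot p] is the skew endomorphism obtained by raising an index of the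
   differential of the contact form: d/dx -> - e2, d/dy -> e1, d/dz -> 0. *)
Definition nil_rot (p : 'rV[R]_3) (a k : 'I_3) : R :=
  [:: vec3 0 (- 1) (- p 0 0 / 2) 0 k; vec3 1 0 (- p 0 1 / 2) 0 k; 0]`_a.

(** Only the square of the contact form w varies with the point. In the sum of the three derivatives
    the multiples of w_l cancel by antisymmetry of [dcontact]; what remains is w_b dw(a, l) + w_a
    dw(b, l), and raising [l] turns dw into [nil_rot]. *)
Lemma christoffel_nil_metric (p : 'rV[R]_3) k a b :
  christoffel (@nil_metric R) k a b p =
  2^-1 * (contact p 0 b * nil_rot p a k + contact p 0 a * nil_rot p b k).
Proof.
rewrite /christoffel big_ord3 !derive_nil_metric invmx_nil_metric.
rewrite !mxE !big_ord1 !mxE /dcontact.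
have [] := ord3P k => ->; have [] := ord3P a => ->; have [] := ord3P b => ->;
  by rewrite /nil_rot ?vec3E /=; field.
Qed.
End Vec3.

(** * Partial derivatives, the chain rule and open rectangles *)

Section Calculus.
Variable R : realType.

Lemma differentiable_rowP n m (V : 'rV[R]_n.+1 -> 'rV[R]_m.+1) p :
  (forall k, differentiable (fun q => V q 0 k) p) -> differentiable V p.
Proof.
move=> dV.
have -> : V = \sum_(k < m.+1) (fun q => V q 0 k *: delta_mx 0 k).
  by apply/funext => q; rewrite fct_sumE -row_sum_delta.
by apply: differentiable_sum => k; exact: differentiableZl.
Qed.

Lemma differentiable_entry n m (V : 'rV[R]_n.+1 -> 'rV[R]_m.+1) p k :
  differentiable V p -> differentiable (fun q => V q 0 k) p.
Proof.
move=> dV.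
apply: (@differentiable_comp _ _ _ _ V (fun w : 'rV[R]_m.+1 => w 0 k)) => //.
exact: differentiable_coord.
Qed.

Lemma jacobianE n m (V : 'rV[R]_n.+1 -> 'rV[R]_m.+1) p i k :
  differentiable V p ->
  jacobian V p i k = 'D_(delta_mx 0 i) (fun q => V q 0 k) p.
Proof.
move=> dV; have := deriveEjacobian (delta_mx 0 i) dV.
rewrite -rowE derive_mx; last exact: diff_derivable.
by move=> /matrixP/(_ 0 k); rewrite !mxE.
Qed.

Lemma is_derive_entry n m (V : 'rV[R]_n.+1 -> 'rV[R]_m.+1) p i k :
  differentiable V p ->
  is_derive p (delta_mx 0 i) (fun q => V q 0 k) (jacobian V p i k).
Proof.
move=> dV; rewrite jacobianE//; apply/derivableP/diff_derivable.
exact: differentiable_entry.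
Qed.

Lemma differentiable_comp1 (V : normedModType R) (f : R -> R) (h : V -> R) p :
  differentiable h p -> derivable f (h p) 1 ->
  differentiable (fun q => f (h q)) p.
Proof.
move=> dh /derivable1_diffP df; exact: (@differentiable_comp _ _ _ _ h f).
Qed.

Lemma is_derive_comp1 (V : normedModType R) (f : R -> R) (h : V -> R) p w dh :
  differentiable h p -> derivable f (h p) 1 -> is_derive p w h dh ->
  is_derive p w (fun q => f (h q)) (f^`()%classic (h p) * dh).
Proof.
move=> diff_h df [_ <-].
have dfh := differentiable_comp1 diff_h df.
apply: DeriveDef; first exact: diff_derivable.
rewrite !deriveE//.
rewrite (@diff_comp _ _ _ _ h f)//; last exact/derivable1_diffP.
by rewrite /= deriv1E//= mulrC.
Qed.

(** Serves to differentiate identities that are known only on the open parameter domain. *)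
Lemma near_is_derive0 (V : normedModType R) (f : V -> R) p w df c :
  (\forall q \near p, f q = c) -> is_derive p w f df -> df = 0.
Proof.
move=> fc [_ <-].
by rewrite (near_eq_derive w (g := cst c))// derive_cst.
Qed.

Lemma open_rectangle (I J : set R) : open I -> open J -> open (rectangle I J).
Proof.
move=> oI oJ; have co j : continuous (fun q : 'rV[R]_2 => q 0 j).
  by move=> q; exact/differentiable_continuous/differentiable_coord.
apply: openI; apply: open_comp => //= q _; exact: co.
Qed.
End Calculus.

(** * Inner product, covariant derivative and mean curvature in coordinates *)

Section NilGeometry.
Variable R : realType.

(** This is also the [e3]-component of [v] in the left-invariant frame at [p]; the other two frame
    components are the first two coordinates of [v]. *)
Definition contact_form (p v : 'rV[R]_3) : R :=
  v 0 2 + (p 0 1 * v 0 0 - p 0 0 * v 0 1) / 2.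

Lemma inner_nil_metric (p v w : 'rV[R]_3) : inner (@nil_metric R) p v w =
  v 0 0 * w 0 0 + v 0 1 * w 0 1 + contact_form p v * contact_form p w.
Proof.
rewrite /inner !mxE big_ord3 !mxE !big_ord3 !nil_metricE !mxE /contact_form.
by rewrite ?vec3E /=; field.
Qed.

(** Contracting the Christoffel symbols with [X] and [V] leaves w(V) rot(X) + w(X) rot(V), where w
    is the contact form and rot is given by [nil_rot]. *)
Lemma cov_derivative_nil (r V : 'rV[R]_2 -> 'rV[R]_3) (p : 'rV[R]_2) i k :
  let X := row i (jacobian r p) in
  let e1 := vec3 1 0 (- r p 0 1 / 2) in
  let e2 := vec3 0 1 (r p 0 0 / 2) in
  cov_derivative (@nil_metric R) r V p i k =
  jacobian V p i k
  + 2^-1 * (contact_form (r p) (V p) * (X 0 1 * e1 0 k - X 0 0 * e2 0 k)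
            + contact_form (r p) X * (V p 0 1 * e1 0 k - V p 0 0 * e2 0 k)).
Proof.
rewrite /= /cov_derivative mxE.
generalize (jacobian V p) (jacobian r p) (r p) (V p) => K J q w.
rewrite !big_ord3 !christoffel_nil_metric /contact_form /nil_rot /=.
rewrite !(mxE, vec3E) /=.
generalize (q 0 0) (q 0 1) (w 0 0) (w 0 1) (w 0 2) (J i 0) (J i 1) (J i 2).
by move=> *; have [] := ord3P k => -> /=; field.
Qed.

Lemma row_free_graph a b (M : 'M[R]_(2, 3)) :
  row 0 M = vec3 1 0 a -> row 1 M = vec3 0 1 b -> row_free M.
Proof.
(* Projection onto the first two coordinates is a right inverse. *)
move=> /rowP r0 /rowP r1; apply/row_freeP; exists (pid_mx 2).
apply/matrixP => i j; rewrite !mxE big_ord3 !mxE /=.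
move: (r0 0) (r0 1) (r1 0) (r1 1); rewrite !mxE /= => m00 m01 m10 m11.
have [] := ord2P i => ->; have [] := ord2P j => ->;
  rewrite ?m00 ?m01 ?m10 ?m11 /=; ring.
Qed.

(* In the frame of a graph the first two coordinates of a tangent vector are its
   coordinates in the basis of partial derivatives, so the trace of the shape
   operator can be read off the first two columns of the covariant derivative. *)
Lemma mean_curvature_graph (g : 'rV[R]_3 -> 'M[R]_3)
    (r N : 'rV[R]_2 -> 'rV[R]_3) p a b :
    row 0 (jacobian r p) = vec3 1 0 a -> row 1 (jacobian r p) = vec3 0 1 b ->
    (forall i, cov_derivative g r N p i 2 =
       cov_derivative g r N p i 0 * a + cov_derivative g r N p i 1 * b) ->
  mean_curvature g r N p =
  - 2^-1 * (cov_derivative g r N p 0 0 + cov_derivative g r N p 1 1).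
Proof.
rewrite /mean_curvature /shape_operator.
generalize (cov_derivative g r N p) (jacobian r p) => C J r0 r1 Ct.
pose S : 'M[R]_2 := \matrix_(i, j) C i (widen_ord (isT : (2 <= 3)%N) j).
have w0 : widen_ord (isT : (2 <= 3)%N) 0 = 0 :> 'I_3 by exact/val_inj.
have w1 : widen_ord (isT : (2 <= 3)%N) 1 = 1 :> 'I_3 by exact/val_inj.
have J0 k : J 0 k = vec3 1 0 a 0 k by rewrite -r0 [RHS]mxE.
have J1 k : J 1 k = vec3 0 1 b 0 k by rewrite -r1 [RHS]mxE.
have CS : C = S *m J.
  apply/matrixP => i k; rewrite !mxE big_ord2 !mxE w0 w1 J0 J1.
  by have [] := ord3P k => ->; rewrite !vec3E ?Ct ?mulr1 ?mulr0 ?addr0 ?add0r.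
(* As the Jacobian is row free, [pinvmx] cancels it, so the shape operator is [- S]. *)
rewrite {1}CS mulNmx mulmxKp; last exact: row_free_graph r0 r1.
by rewrite /mxtrace big_ord2 !mxE w0 w1 -opprD mulrN mulNr.
Qed.
End NilGeometry.

(** * Tangent vectors of the translation surface *)

Section TranslationSurface.
Variables (R : realType) (I J : set R) (u v : R -> R).
Hypotheses (oI : open I) (oJ : open J).
Hypotheses (du : forall x, I x -> derivable u x 1).
Hypotheses (dv : forall y, J y -> derivable v y 1).
Hypotheses (ddu : forall x, I x -> derivable u^`()%classic x 1).
Hypotheses (ddv : forall y, J y -> derivable v^`()%classic y 1).

Let r := translation_surface1 u v.
Let D := rectangle I J.

(* [r_x = e1 + slope1 *: e3] and [r_y = e2 + slope2 *: e3] in the left-invariant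
   frame. *)
Definition slope1 (p : 'rV[R]_2) : R := u^`()%classic (p 0 0) + p 0 1.
Definition slope2 (p : 'rV[R]_2) : R := v^`()%classic (p 0 1).
Definition slope_norm2 p := 1 + slope1 p * slope1 p + slope2 p * slope2 p.

Lemma slope_norm2_gt0 p : 0 < slope_norm2 p.
Proof.
by rewrite /slope_norm2 -addrA ltr_pwDl// addr_ge0// -expr2 sqr_ge0.
Qed.

Lemma translation_surface1E p :
  r p = vec3 (p 0 0) (p 0 1) (u (p 0 0) + v (p 0 1) + p 0 0 * p 0 1 / 2).
Proof.
rewrite /r /translation_surface1 /translation_surface /nil_op !vec3E.
by congr vec3; ring.
Qed.

Lemma is_derive_u p w : D p ->
  is_derive p w (fun q : 'rV[R]_2 => u (q 0 0)) (u^`()%classic (p 0 0) * w 0 0).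
Proof.
move=> [Ip _]; apply: is_derive_comp1; [exact: differentiable_coord|exact: du|].
exact: is_derive_coord.
Qed.

Lemma is_derive_v p w : D p ->
  is_derive p w (fun q : 'rV[R]_2 => v (q 0 1)) (v^`()%classic (p 0 1) * w 0 1).
Proof.
move=> [_ Jp]; apply: is_derive_comp1; [exact: differentiable_coord|exact: dv|].
exact: is_derive_coord.
Qed.

Lemma is_derive_slope1 p w : D p ->
  is_derive p w slope1 (u^`()^`()%classic (p 0 0) * w 0 0 + w 0 1).
Proof.
move=> [Ip _]; apply: is_deriveD; last exact: is_derive_coord.
apply: is_derive_comp1; [exact: differentiable_coord|exact: ddu|].
exact: is_derive_coord.
Qed.

Lemma is_derive_slope2 p w : D p ->
  is_derive p w slope2 (v^`()^`()%classic (p 0 1) * w 0 1).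
Proof.
move=> [_ Jp].
apply: is_derive_comp1; [exact: differentiable_coord|exact: ddv|].
exact: is_derive_coord.
Qed.

Lemma differentiable_slope1 p : D p -> differentiable slope1 p.
Proof.
move=> [Ip _]; apply: differentiableD; last exact: differentiable_coord.
by apply: differentiable_comp1; [exact: differentiable_coord|exact: ddu].
Qed.

Lemma differentiable_slope2 p : D p -> differentiable slope2 p.
Proof.
move=> [_ Jp].
by apply: differentiable_comp1; [exact: differentiable_coord|exact: ddv].
Qed.

Lemma differentiable_surface p : D p -> differentiable r p.
Proof.
move=> [Ip Jp]; have d0 : differentiable (fun q : 'rV[R]_2 => q 0 0) p.
  exact: differentiable_coord.
have d1 : differentiable (fun q : 'rV[R]_2 => q 0 1) p.
  exact: differentiable_coord.
apply: differentiable_rowP => k.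
under eq_fun do rewrite translation_surface1E.
have [] := ord3P k => ->; (under eq_fun do rewrite vec3E) => //.
apply: differentiableD; last first.
  by apply: differentiableM => //; exact: differentiableM.
by apply: differentiableD; apply: differentiable_comp1; auto.
Qed.

Lemma row0_jacobian p : D p ->
  row 0 (jacobian r p) = vec3 1 0 (slope1 p - p 0 1 / 2).
Proof.
move=> Dp; apply/rowP => k; rewrite [LHS]mxE.
rewrite jacobianE; last exact: differentiable_surface.
under eq_fun do rewrite translation_surface1E.
have := is_derive_u (delta_mx 0 0) Dp; have := is_derive_v (delta_mx 0 0) Dp.
have := is_derive_coord p (delta_mx 0 0) 0.
have := is_derive_coord p (delta_mx 0 0) 1.
rewrite !mxE /= => d0 d1 dvp dup.
have [] := ord3P k => ->; (under eq_fun do rewrite vec3E); rewrite derive_val ?vec3E//.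
by rewrite /slope1 /GRing.scale /=; field.
Qed.

Lemma row1_jacobian p : D p ->
  row 1 (jacobian r p) = vec3 0 1 (slope2 p + p 0 0 / 2).
Proof.
move=> Dp; apply/rowP => k; rewrite [LHS]mxE.
rewrite jacobianE; last exact: differentiable_surface.
under eq_fun do rewrite translation_surface1E.
have := is_derive_u (delta_mx 0 1) Dp; have := is_derive_v (delta_mx 0 1) Dp.
have := is_derive_coord p (delta_mx 0 1) 0.
have := is_derive_coord p (delta_mx 0 1) 1.
rewrite !mxE /= => d0 d1 dvp dup.
have [] := ord3P k => ->; (under eq_fun do rewrite vec3E); rewrite derive_val ?vec3E//.
by rewrite /slope2 /GRing.scale /=; field.
Qed.

Lemma surface_immersion : immersion_on r D.
Proof.
move=> p Dp; split; first exact: differentiable_surface.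
by apply: row_free_graph; [exact: row0_jacobian|exact: row1_jacobian].
Qed.

(** * Orthogonality to the surface and an explicit unit normal *)

Lemma inner_surface0 p w : D p ->
  inner (@nil_metric R) (r p) w (row 0 (jacobian r p)) =
  w 0 0 + contact_form (r p) w * slope1 p.
Proof.
move=> Dp; rewrite inner_nil_metric row0_jacobian// /contact_form.
by rewrite !translation_surface1E !vec3E; field.
Qed.

Lemma inner_surface1 p w : D p ->
  inner (@nil_metric R) (r p) w (row 1 (jacobian r p)) =
  w 0 1 + contact_form (r p) w * slope2 p.
Proof.
move=> Dp; rewrite inner_nil_metric row1_jacobian// /contact_form.
by rewrite !translation_surface1E !vec3E; field.
Qed.

(** The vector - slope1 e1 - slope2 e2 + e3, normalised and written in the coordinate frame; hence
    the correction in the third coordinate. *)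
Definition surface_normal (p : 'rV[R]_2) : 'rV[R]_3 :=
  (Num.sqrt (slope_norm2 p))^-1 *:
    vec3 (- slope1 p) (- slope2 p)
      (1 + (p 0 1 * slope1 p - p 0 0 * slope2 p) / 2).

Lemma surface_normalE p k : surface_normal p 0 k =
  (Num.sqrt (slope_norm2 p))^-1 *
  vec3 (- slope1 p) (- slope2 p)
    (1 + (p 0 1 * slope1 p - p 0 0 * slope2 p) / 2) 0 k.
Proof. by rewrite [LHS]mxE. Qed.

Lemma unit_normal_surface_normal :
  unit_normal_on (@nil_metric R) r D surface_normal.
Proof.
move=> p Dp; have W0 := slope_norm2_gt0 p.
have sW0 : Num.sqrt (slope_norm2 p) != 0 by rewrite gt_eqF// sqrtr_gt0.
have cE : contact_form (r p) (surface_normal p) = (Num.sqrt (slope_norm2 p))^-1.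
  rewrite /contact_form translation_surface1E.
  by rewrite !surface_normalE !vec3E; field.
split.
- have d1 := differentiable_slope1 Dp; have d2 := differentiable_slope2 Dp.
  have dW : differentiable slope_norm2 p.
    apply: differentiableD; last exact: differentiableM.
    by apply: differentiableD => //; exact: differentiableM.
  have dc (k : 'I_2) : differentiable (fun q : 'rV[R]_2 => q 0 k) p.
    exact: differentiable_coord.
  apply: differentiable_rowP => k.
  under eq_fun do rewrite surface_normalE.
  apply: differentiableM.
    apply: differentiableV => //; apply: differentiable_comp1 => //.
    exact/ex_derive/is_derive1_sqrt.
  have [] := ord3P k => ->; (under eq_fun do rewrite vec3E).
  + exact: differentiableN.
  + exact: differentiableN.
  + apply: differentiableD => //; apply: differentiableM => //.
    by apply: differentiableB; exact: differentiableM.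
- move=> i; have [] := ord2P i => ->.
  + by rewrite inner_surface0// cE surface_normalE !vec3E; ring.
  + by rewrite inner_surface1// cE surface_normalE !vec3E; ring.
- rewrite inner_nil_metric cE !surface_normalE !vec3E.
  have := sqr_sqrtr (ltW W0); rewrite expr2 {3}/slope_norm2 => sE.
  (* With 1 written as a quotient, [sE] can be applied to the numerator alone; the rest is an
     identity of rational functions. *)
  have -> : 1 = (Num.sqrt (slope_norm2 p) * Num.sqrt (slope_norm2 p)) /
    (Num.sqrt (slope_norm2 p) * Num.sqrt (slope_norm2 p)) by field.
  by rewrite [X in _ = X / _]sE; field.
Qed.

(** * Mean curvature and the minimal surface equation *)

Definition minimality_expr (x y : R) : R :=
  (1 + v^`()%classic y * v^`()%classic y) * u^`()^`()%classic x
  - (u^`()%classic x + y) * v^`()%classic y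
  + (1 + (u^`()%classic x + y) * (u^`()%classic x + y)) * v^`()^`()%classic y.

(* Only the orthogonality relations satisfied by [N] are differentiated, so no
   choice of orientation has to be made. *)
Lemma mean_curvature_surface N p : unit_normal_on (@nil_metric R) r D N -> D p ->
  exists2 c, c != 0 & mean_curvature (@nil_metric R) r N p =
                      c * minimality_expr (p 0 0) (p 0 1).
Proof.
move=> NN Dp; pose c q := contact_form (r q) (N q).
(* Openness of the domain is what allows the relations satisfied by [N] to be differentiated at
   [p]. *)
have nearD : \forall q \near p, D q.
  by apply: open_nbhs_nbhs; split => //; exact: open_rectangle.
have N0E q : D q -> N q 0 0 = - (c q * slope1 q).
  move=> Dq; have [_ /(_ 0) + _] := NN q Dq.
  by rewrite inner_surface0// => /eqP; rewrite addr_eq0 => /eqP.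
have N1E q : D q -> N q 0 1 = - (c q * slope2 q).
  move=> Dq; have [_ /(_ 1) + _] := NN q Dq.
  by rewrite inner_surface1// => /eqP; rewrite addr_eq0 => /eqP.
have ccE q : D q -> c q * c q * slope_norm2 q = 1.
  move=> Dq; have [_ _] := NN q Dq; rewrite inner_nil_metric => <-.
  rewrite -/(c q) N0E// N1E//.
  by rewrite /slope_norm2; ring.
have [dN _ _] := NN p Dp.
(* An abstract name for the entries of the Jacobian keeps them atomic in the computations below. *)
have [K KE] : exists K : 'I_2 -> 'I_3 -> R, forall i k, jacobian N p i k = K i k.
  by exists (jacobian N p).
have dn i k : is_derive p (delta_mx 0 i) (fun q => N q 0 k) (K i k).
  by rewrite -KE; exact: is_derive_entry.
have dx i : is_derive p (delta_mx 0 i) (fun q : 'rV[R]_2 => q 0 0) (i == 0)%:R.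
  by have := is_derive_coord p (delta_mx 0 i) 0; rewrite mxE eq_sym.
have dy i : is_derive p (delta_mx 0 i) (fun q : 'rV[R]_2 => q 0 1) (i == 1)%:R.
  by have := is_derive_coord p (delta_mx 0 i) 1; rewrite mxE eq_sym.
have ds1 i := is_derive_slope1 (delta_mx 0 i) Dp.
have ds2 i := is_derive_slope2 (delta_mx 0 i) Dp.
have cE : c = (fun q => N q 0 2 + (q 0 1 * N q 0 0 - q 0 0 * N q 0 1) / 2).
  by apply/funext => q; rewrite /c /contact_form translation_surface1E !vec3E.
have is_dc i : is_derive p (delta_mx 0 i) c (K i 2 + ((i == 1)%:R * N p 0 0
    + p 0 1 * K i 0 - (i == 0)%:R * N p 0 1 - p 0 0 * K i 1) / 2).
  rewrite cE; apply: is_derive_eq; rewrite /GRing.scale /=.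
  by move: (K i 0) (K i 1) (K i 2) => *; field.
have [dc dcE] : exists dc : 'I_2 -> R, forall i, K i 2 + ((i == 1)%:R * N p 0 0
    + p 0 1 * K i 0 - (i == 0)%:R * N p 0 1 - p 0 0 * K i 1) / 2 = dc i.
  by eexists.
have {}is_dc i : is_derive p (delta_mx 0 i) c (dc i) by rewrite -dcE.
set U := u^`()^`()%classic (p 0 0) in ds1 *.
set V := v^`()^`()%classic (p 0 1) in ds2 *.
(* Derivative of the orthogonality relation N_0 + c slope1 = 0, valid near [p]. *)
have K0E i : K i 0 = - (dc i * slope1 p + c p * (U * (i == 0)%:R + (i == 1)%:R)).
  apply/eqP; rewrite -addr_eq0; apply/eqP.
  apply: (near_is_derive0 (w := delta_mx 0 i)
    (f := fun q => N q 0 0 + c q * slope1 q) (c := 0)).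
    by apply: filterS nearD => q Dq; rewrite N0E// addNr.
  apply: is_derive_eq; rewrite /GRing.scale /= !mxE /= ![_ == i]eq_sym.
  by move: (K i 0) (dc i) => *; ring.
have K1E i : K i 1 = - (dc i * slope2 p + c p * (V * (i == 1)%:R)).
  apply/eqP; rewrite -addr_eq0; apply/eqP.
  apply: (near_is_derive0 (w := delta_mx 0 i)
    (f := fun q => N q 0 1 + c q * slope2 q) (c := 0)).
    by apply: filterS nearD => q Dq; rewrite N1E// addNr.
  apply: is_derive_eq; rewrite /GRing.scale /= !mxE /= ![_ == i]eq_sym.
  by move: (K i 1) (dc i) => *; ring.
have W0 : slope_norm2 p != 0 by rewrite gt_eqF// slope_norm2_gt0.
have c0 : c p != 0.
  apply/eqP => c0; have := ccE p Dp; rewrite c0 !mul0r => /eqP.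
  by rewrite eq_sym oner_eq0.
(* Differentiating the normalisation c^2 [slope_norm2] = 1 and dividing by 2 c gives a linear
   equation for [dc i]. *)
have dcc i : dc i = - (c p * (slope1 p * (U * (i == 0)%:R + (i == 1)%:R)
     + slope2 p * (V * (i == 1)%:R))) / slope_norm2 p.
  have : dc i * c p * slope_norm2 p *+ 2 + c p * c p *
     (slope1 p * (U * (i == 0)%:R + (i == 1)%:R)
     + slope2 p * (V * (i == 1)%:R)) *+ 2 = 0.
    apply: (near_is_derive0 (w := delta_mx 0 i)
      (f := fun q => c q * c q * (1 + slope1 q * slope1 q + slope2 q * slope2 q))
      (c := 1)); first exact: filterS nearD.
    apply: is_derive_eq; rewrite /GRing.scale /slope_norm2 /= !mxE /= ![_ == i]eq_sym.
    by move: (dc i) => *; ring.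
  rewrite -mulrnDl => /eqP; rewrite mulrn_eq0 /= => /eqP h.
  apply: (mulIf W0); apply: (mulfI c0); rewrite divfK//.
  by apply/eqP; rewrite -subr_eq0; apply/eqP; rewrite -[RHS]h; ring.
have X0 : contact_form (r p) (row 0 (jacobian r p)) = slope1 p.
  by rewrite row0_jacobian// /contact_form translation_surface1E !vec3E; field.
have X1 : contact_form (r p) (row 1 (jacobian r p)) = slope2 p.
  by rewrite row1_jacobian// /contact_form translation_surface1E !vec3E; field.
pose e1 := vec3 1 0 (- p 0 1 / 2); pose e2 := vec3 0 1 (p 0 0 / 2).
have cov0 k : cov_derivative (@nil_metric R) r N p 0 k = K 0 k + 2^-1 *
    (slope1 p * (N p 0 1 * e1 0 k - N p 0 0 * e2 0 k) - c p * e2 0 k).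
  rewrite cov_derivative_nil KE X0 row0_jacobian// translation_surface1E.
  by rewrite !vec3_0 !vec3_1 -/e1 -/e2 -translation_surface1E -/(c p); ring.
have cov1 k : cov_derivative (@nil_metric R) r N p 1 k = K 1 k + 2^-1 *
    (slope2 p * (N p 0 1 * e1 0 k - N p 0 0 * e2 0 k) + c p * e1 0 k).
  rewrite cov_derivative_nil KE X1 row1_jacobian// translation_surface1E.
  by rewrite !vec3_0 !vec3_1 -/e1 -/e2 -translation_surface1E -/(c p); ring.
have K2E i : K i 2 = dc i - ((i == 1)%:R * N p 0 0
    + p 0 1 * K i 0 - (i == 0)%:R * N p 0 1 - p 0 0 * K i 1) / 2.
  by rewrite -dcE addrK.
(* Since c^2 [slope_norm2] = 1, this factor is, up to sign, half of [slope_norm2] to the power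
   -3/2. *)
exists (c p / (2 * slope_norm2 p)); first by rewrite mulf_neq0// invr_neq0// mulf_neq0.
have DU : slope_norm2 p = 1 + slope1 p * slope1 p + slope2 p * slope2 p by [].
rewrite (mean_curvature_graph (row0_jacobian Dp) (row1_jacobian Dp)).
  rewrite cov0 cov1 /e1 /e2 !vec3E !K0E !K1E !N0E// !N1E// !dcc.
  rewrite /minimality_expr -/U -/V -/(slope1 p) -/(slope2 p) /=.
  move: (c p) (slope1 p) (slope2 p) (slope_norm2 p) W0 DU => C P Q W W0 DU.
  by rewrite DU in W0 *; field.
(* What remains is the premise of [mean_curvature_graph] that the covariant derivative of the normal
   is tangent. *)
move=> i; have [] := ord2P i => ->;
  rewrite ?cov0 ?cov1 /e1 /e2 !vec3E K2E !K0E !K1E !N0E// !N1E// !dcc /=;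
  move: (c p) (slope1 p) (slope2 p) (slope_norm2 p) W0 DU => C P Q W W0 DU;
  by rewrite DU in W0 *; field.
Qed.

(** The factor relating mean curvature to [minimality_expr] is nonzero for every unit normal, so any
    given normal yields the equation; conversely [surface_normal] is a witness. *)
Lemma minimal_surfaceP :
  minimal_surface (@nil_metric R) r D <->
  forall x y, I x -> J y -> minimality_expr x y = 0.
Proof.
split=> [[_ [N NN H0]] x y Ix Jy|E0].
  pose p : 'rV[R]_2 := \row_(k < 2) [:: x; y]`_k.
  have [p0 p1] : p 0 0 = x /\ p 0 1 = y by rewrite !mxE.
  have Dp : D p by split; rewrite /= ?p0 ?p1.
  have [c c0] := mean_curvature_surface NN Dp.
  by rewrite H0// p0 p1 => /esym/eqP; rewrite mulf_eq0 (negPf c0) => /eqP.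
split; first exact: surface_immersion.
exists surface_normal; first exact: unit_normal_surface_normal.
move=> p Dp; have [c _ ->] := mean_curvature_surface unit_normal_surface_normal Dp.
by case: Dp => Ip Jp; rewrite E0// mulr0.
Qed.
End TranslationSurface.

(** * Constancy on intervals and rigidity of u' *)

Section RealAnalysis.
Variable R : realType.

Lemma is_derive0_itv_cst (I : set R) (f : R -> R) : is_interval I ->
  (forall x, I x -> is_derive x 1 f 0) ->
  forall x y, I x -> I y -> f x = f y.
Proof.
move=> itvI f0 x y; wlog xy : x y / x <= y => [hw Ix Iy|Ix Iy].
  by have [xy|/ltW yx] := leP x y; [exact: hw|exact/esym/hw].
have sI z : z \in `[x, y] -> I z.
  by rewrite in_itv => /= xzy; exact: itvI Ix Iy _ _.
have [||c _] := @MVT_segment _ f (fun=> 0) x y xy.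
- move=> z zxy; apply: f0; apply: sI.
  by apply: subset_itv_oo_cc zxy.
- apply: derivable_within_continuous => z /sI Iz.
  by have [] := f0 z Iz.
- by rewrite mul0r => /eqP; rewrite subr_eq0 => /eqP.
Qed.

(** Three equally spaced points suffice to read off the leading coefficient of a quadratic
    polynomial as a second difference. *)
Lemma open_three_points (J : set R) y : open J -> J y ->
  exists2 h, h != 0 & J (y - h) /\ J (y + h).
Proof.
move=> oJ Jy; have /nbhs_ballP[e /= e0 eJ] : nbhs y J by exact: open_nbhs_nbhs.
exists (e / 2); first by rewrite gt_eqF// divr_gt0.
have e2 : `|e / 2| < e by rewrite gtr0_norm ?divr_gt0// ltr_pdivrMr// ltr_pMr// ltr1n.
split; apply: eJ; rewrite /ball /=.
  by rewrite opprB addrC subrK.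
by rewrite opprD addrA subrr sub0r normrN.
Qed.

(* [(s, t)] are values of (u'', u') at three points, [p] and [q] are v' and v''.
   The second and first differences in [t] of the minimality equation give
   v'' = - al (1 + v'^2) and v' = (be - al (t1 + t2 + 2 y)) (1 + v'^2) with
   constant [al] and [be]; the equation itself then says that a polynomial in [y]
   with leading coefficient [al] vanishes on [J]. *)
Lemma minimality_rigid (J : set R) (p q : R -> R) (s1 s2 s3 t1 t2 t3 : R) :
  open J -> J !=set0 -> t1 != t2 -> t3 = (t1 + t2) / 2 ->
  (forall s t, (s, t) \in [:: (s1, t1); (s2, t2); (s3, t3)] -> forall y, J y ->
     (1 + p y * p y) * s - (t + y) * p y + (1 + (t + y) * (t + y)) * q y = 0) ->
  forall y, J y -> p y = 0 /\ q y = 0.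
Proof.
move=> oJ [y0 Jy0] t12 t3E E.
have E1 := E s1 t1 (mem_head _ _).
have E2 := E s2 t2; have E3 := E s3 t3.
rewrite !inE !eqxx ?orbT in E2 E3; have {}E2 := E2 isT; have {}E3 := E3 isT.
(* [al] and [be] are the second and first divided differences of s as a function of t, with [t3] the
   midpoint of [t1] and [t2]. *)
pose al := (s1 - 2 * s3 + s2) * 2 / (t1 - t2) ^+ 2.
pose be := (s1 - s2) / (t1 - t2).
have d0 : t1 - t2 != 0 by rewrite subr_eq0.
have qE y : J y -> q y = - al * (1 + p y * p y).
  move=> Jy; apply: (mulIf (expf_neq0 2 d0)).
  move: (E1 y Jy) (E2 y Jy) (E3 y Jy); rewrite t3E => h1 h2 h3.
  transitivity (- ((s1 - 2 * s3 + s2) * 2) * (1 + p y * p y)); first lra.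
  by rewrite /al; field.
have pE y : J y -> p y = (be - al * (t1 + t2 + 2 * y)) * (1 + p y * p y).
  move=> Jy; apply: (mulIf d0); move: (E1 y Jy) (E2 y Jy) => h1 h2.
  transitivity ((s1 - s2) * (1 + p y * p y)
    + (t1 - t2) * (t1 + t2 + 2 * y) * q y); first lra.
  by rewrite qE// /be; field.
have polE y : J y ->
  s1 - (t1 + y) * (be - al * (t1 + t2 + 2 * y)) - al * (1 + (t1 + y) ^+ 2) = 0.
  move=> Jy; have W0 : 1 + p y * p y != 0.
    by rewrite gt_eqF// ltr_pwDl// -expr2 sqr_ge0.
  apply: (mulIf W0); rewrite mul0r -[RHS](E1 y Jy) (qE y Jy).
  by rewrite [X in _ = _ - _ * X + _](pE y Jy); ring.
have [h h0 [Jm Jp]] := open_three_points oJ Jy0.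
(* The y^2 coefficient in [polE] is 2 al - al = al, so the second difference with step [h] is 2 al
   h^2. Once [al] is 0, the first difference is - be h. *)
have al0 : al = 0.
  move: (polE _ Jm) (polE _ Jp) (polE _ Jy0) => em ep e0.
  by apply: (mulIf (expf_neq0 2 h0)); lra.
have be0 : be = 0.
  move: (polE _ Jp) (polE _ Jy0); rewrite al0 => ep e0.
  by apply: (mulIf h0); lra.
by move=> y Jy; rewrite (qE y Jy) {1}(pE y Jy) al0 be0 oppr0 !mul0r subr0 mul0r.
Qed.

(** * The profile function and its derivative *)

Lemma sqrt_1sqr_gt (s : R) : `|s| < Num.sqrt (1 + s ^+ 2).
Proof. by rewrite -sqrtr_sqr ltr_sqrt ?ltrDr// ltr_pwDl// sqr_ge0. Qed.

Lemma is_derive_sqrt_1sqr (a y : R) :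
  is_derive y 1 (fun z => Num.sqrt (1 + (a + z) ^+ 2))
    ((a + y) / Num.sqrt (1 + (a + y) ^+ 2)).
Proof.
have W0 : 0 < 1 + (a + y) ^+ 2 by rewrite ltr_pwDl// sqr_ge0.
have dW : is_derive y 1 (fun z => 1 + (a + z) ^+ 2) (2 * (a + y)).
  apply: is_derive_eq; rewrite /GRing.scale /=; ring.
have dS := is_derive1_sqrt W0.
apply: (is_derive_eq (is_derive1_comp (g := fun z => 1 + (a + z) ^+ 2) dS dW)).
have S0 : Num.sqrt (1 + (a + y) ^+ 2) != 0 by rewrite gt_eqF// sqrtr_gt0.
by rewrite /GRing.scale /=; field.
Qed.

(** The logarithm is arsinh s, and the sum is twice an antiderivative of sqrt (1 + s^2). *)
Definition profile (s : R) : R :=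
  s * Num.sqrt (1 + s ^+ 2) + ln (s + Num.sqrt (1 + s ^+ 2)).

Lemma is_derive_profile (a y : R) :
  is_derive y 1 (fun z => profile (a + z)) (2 * Num.sqrt (1 + (a + y) ^+ 2)).
Proof.
have dS := is_derive_sqrt_1sqr a y.
have S0 : 0 < Num.sqrt (1 + (a + y) ^+ 2) by rewrite sqrtr_gt0 ltr_pwDl// sqr_ge0.
(* The logarithm is differentiated at a positive argument, as the root exceeds the absolute value of
   [a + y]. *)
have L0 : 0 < a + y + Num.sqrt (1 + (a + y) ^+ 2).
  have := sqrt_1sqr_gt (a + y); rewrite ltr_norml => /andP[+ _].
  by rewrite -subr_gt0 opprK addrC.
have dL : is_derive y 1 (fun z => a + z + Num.sqrt (1 + (a + z) ^+ 2))
   (1 + (a + y) / Num.sqrt (1 + (a + y) ^+ 2)).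
  by apply: is_derive_eq; rewrite add0r.
have dl := is_derive1_comp
  (g := fun z => a + z + Num.sqrt (1 + (a + z) ^+ 2)) (is_derive1_ln L0) dL.
rewrite /profile.
have SE : Num.sqrt (1 + (a + y) ^+ 2) ^+ 2 = 1 + (a + y) ^+ 2.
  by rewrite sqr_sqrtr// addr_ge0// sqr_ge0.
apply: is_derive_eq; rewrite /GRing.scale /=.
move: (Num.sqrt _) SE S0 L0 => s sE s0 L0.
have L1 : a + y + s != 0 by rewrite gt_eqF.
have s1 : s != 0 by rewrite gt_eqF.
(* The factor [a + y + s] cancels without using [sE]; only the last simplification to [2 * s] needs
   it. *)
transitivity (s + (1 + (a + y) ^+ 2) / s); last by rewrite -sE; field.
by field; rewrite s1.
Qed.

(** * Solving the minimal surface equation *)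

Lemma is_derive_derive1 (f : R -> R) x :
  derivable f x 1 -> is_derive x 1 f (f^`()%classic x).
Proof. by move=> df; rewrite derive1E; exact: derivableP. Qed.

(** A derivative depends only on the germ, so closed formulas valid on [I] alone can be
    differentiated, repeatedly. *)
Lemma derive1_open_eq (I : set R) (f g : R -> R) x l : open I ->
  (forall z, I z -> f z = g z) -> I x -> is_derive x 1 g l ->
  f^`()%classic x = l.
Proof.
move=> oI fg Ix dg; rewrite derive1E.
have : is_derive x 1 f l.
  apply: near_eq_is_derive dg.
  by apply: filterS (open_nbhs_nbhs (conj oI Ix)) => z /fg ->.
by case.
Qed.

Lemma minimal_translation_ode (I J : set R) (u v : R -> R) :
  open I -> is_interval I -> I !=set0 -> open J -> is_interval J -> J !=set0 ->
  smooth_on I u -> smooth_on J v ->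
  (forall x y, I x -> J y -> minimality_expr u v x y = 0) <->
  exists a c u0 v0 : R,
    (forall x, I x -> u x = a * x + u0) /\
    (forall y, J y -> v y = c * profile (a + y) + v0).
Proof.
move=> oI itvI [x0 Ix0] oJ itvJ [y0 Jy0] su sv.
have du x (Ix : I x) := is_derive_derive1 (su 0%N x Ix).
have ddu x (Ix : I x) := is_derive_derive1 (su 1%N x Ix).
have dv y (Jy : J y) := is_derive_derive1 (sv 0%N y Jy).
have ddv y (Jy : J y) := is_derive_derive1 (sv 1%N y Jy).
rewrite /= in du ddu dv ddv.
split=> [E|[a [c [u0 [v0 [uE vE]]]]] x y Ix Jy]; last first.
  have u1 z : I z -> u^`()%classic z = a.
    move=> Iz; apply: (derive1_open_eq oI uE Iz).
    by apply: is_derive_eq; rewrite /GRing.scale /=; ring.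
  have u2 : u^`()^`()%classic x = 0 by apply: (derive1_open_eq oI u1 Ix).
  have v1 z : J z -> v^`()%classic z = c * (2 * Num.sqrt (1 + (a + z) ^+ 2)).
    move=> Jz; apply: (derive1_open_eq oJ vE Jz).
    have dp := is_derive_profile a z.
    by apply: is_derive_eq; rewrite /GRing.scale /=; ring.
  have v2 : v^`()^`()%classic y =
      c * (2 * ((a + y) / Num.sqrt (1 + (a + y) ^+ 2))).
    apply: (derive1_open_eq oJ v1 Jy).
    have dS := is_derive_sqrt_1sqr a y.
    by apply: is_derive_eq; rewrite /GRing.scale /=; ring.
  have S0 : 0 < Num.sqrt (1 + (a + y) ^+ 2).
    by rewrite sqrtr_gt0 ltr_pwDl// sqr_ge0.
  have SE : Num.sqrt (1 + (a + y) ^+ 2) ^+ 2 = 1 + (a + y) * (a + y).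
    by rewrite sqr_sqrtr -?expr2// addr_ge0// sqr_ge0.
  rewrite /minimality_expr u1// u2 v1// v2.
  move: (Num.sqrt _) S0 SE => s /lt0r_neq0 s0 <-.
  by field.
have u1_le x1 x2 : I x1 -> I x2 -> x1 <= x2 -> u^`()%classic x1 = u^`()%classic x2.
  move=> Ix1 Ix2 x12; apply/eqP/negP => /negP t12.
  have sI z : z \in `[x1, x2] -> I z.
    by rewrite in_itv => /= zx; exact: itvI Ix1 Ix2 _ _.
  (* u' is continuous, being differentiable, and so attains the midpoint of its two values, as
     [minimality_rigid] requires. *)
  have [||x3 /sI Ix3 t3E] := IVT (f := u^`()%classic)
    (v := (u^`()%classic x1 + u^`()%classic x2) / 2) x12.
  - by apply: derivable_within_continuous => z /sI Iz; have [] := ddu z Iz.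
  - move: (u^`()%classic x1) (u^`()%classic x2) {t12} => t1 t2.
    by rewrite ge_min le_max; have [t12|/ltW t12] := leP t1 t2;
      apply/andP; split; apply/orP; [left|right|right|left]; lra.
  have pq0 := minimality_rigid (s1 := u^`()^`()%classic x1)
    (s2 := u^`()^`()%classic x2) (s3 := u^`()^`()%classic x3)
    (p := v^`()%classic) (q := v^`()^`()%classic) oJ (ex_intro _ y0 Jy0) t12 t3E.
  have {}pq0 : v^`()%classic y0 = 0 /\ v^`()^`()%classic y0 = 0.
    apply: pq0 => // s t; rewrite !inE.
    by case/or3P => /eqP[-> ->] y Jy; exact: E.
  (* With v' = v'' = 0 at [y0] the equation reads u'' = 0 on all of [I], which contradicts the two
     distinct values of u'. *)
  move/eqP: t12; apply; apply: (is_derive0_itv_cst itvI) => // x Ix.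
  have := E x y0 Ix Jy0; rewrite /minimality_expr !pq0.1 pq0.2.
  rewrite !mulr0 addr0 subr0 addr0 mul1r => <-; exact: ddu.
have u1 x : I x -> u^`()%classic x = u^`()%classic x0.
  by move=> Ix; have [xx|/ltW xx] := leP x x0; [|apply/esym]; exact: u1_le.
set a := u^`()%classic x0 in u1.
have u2 x : I x -> u^`()^`()%classic x = 0.
  by move=> Ix; apply: (derive1_open_eq oI u1 Ix).
pose S y := Num.sqrt (1 + (a + y) ^+ 2).
have S0 y : S y != 0 by rewrite gt_eqF// sqrtr_gt0 ltr_pwDl// sqr_ge0.
have SE y : S y ^+ 2 = 1 + (a + y) * (a + y).
  by rewrite sqr_sqrtr -?expr2// addr_ge0// sqr_ge0.
(* The equation S^2 v'' = (a + y) v' together with S' = (a + y) / S says that v' / S has derivative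
   zero. *)
have v1 y : J y -> v^`()%classic y = v^`()%classic y0 * (S y0)^-1 * S y.
  move=> Jy; apply: (mulIf (invr_neq0 (S0 y))); rewrite mulfK//.
  apply: (is_derive0_itv_cst (f := fun y => v^`()%classic y * (S y)^-1) itvJ) => // z Jz.
  have dvz := ddv z Jz.
  have dS : is_derive z 1 S ((a + z) / S z) by exact: is_derive_sqrt_1sqr.
  have dSV := is_deriveV (S0 z) dS.
  apply: is_derive_eq; rewrite /GRing.scale /=.
  have := E x0 z Ix0 Jz; rewrite /minimality_expr -/a u2// mulr0 sub0r -SE.
  move: (S z) (S0 z) => s s0 /eqP; rewrite addrC subr_eq0 => /eqP h.
  apply: (mulIf (expf_neq0 3 s0)); rewrite mul0r.
  transitivity (s ^+ 2 * v^`()^`()%classic z - (a + z) * v^`()%classic z).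
    by field.
  by rewrite h subrr.
(* The division by 2 compensates for [profile] having derivative 2 S; the additive constants below
   are fixed by the values at [x0] and [y0]. *)
pose c := v^`()%classic y0 / S y0 / 2.
exists a, c, (u x0 - a * x0), (v y0 - c * profile (a + y0)); split=> [x Ix|y Jy].
  apply/eqP; rewrite addrC -subr_eq; apply/eqP.
  apply: (is_derive0_itv_cst (f := fun x => u x - a * x) itvI) => // z Iz.
  have duz := du z Iz.
  by apply: is_derive_eq; rewrite /GRing.scale /= u1// mulr1 subrr.
apply/eqP; rewrite addrC -subr_eq; apply/eqP.
apply: (is_derive0_itv_cst (f := fun y => v y - c * profile (a + y)) itvJ) => // z Jz.
have dvz := dv z Jz; have dp := is_derive_profile a z.
apply: is_derive_eq; rewrite /GRing.scale /= v1// /c -/(S z).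
by move: (S z) (S y0) (S0 y0) => s s' s0; field.
Qed.
End RealAnalysis.

Theorem theorem3p1 (R : realType) (I J : set R) (u v : R -> R)
  (I_open : open I) (I_itv : is_interval I) (I_neq0 : I !=set0)
  (J_open : open J) (J_itv : is_interval J) (J_neq0 : J !=set0)
  (u_smooth : smooth_on I u) (v_smooth : smooth_on J v) :
  minimal_surface (@nil_metric R) (translation_surface1 u v) (rectangle I J) <->
  exists a c u0 v0 : R,
    (forall x, I x -> u x = a * x + u0) /\
    (forall y, J y ->
      v y = c * ((a + y) * Num.sqrt (1 + (a + y) ^+ 2)
                 + ln (a + y + Num.sqrt (1 + (a + y) ^+ 2))) + v0).
Proof.
apply: iff_trans (minimal_translation_ode I_open I_itv I_neq0 J_open J_itv J_neq0
  u_smooth v_smooth).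
by apply: minimal_surfaceP => // z Iz;
  [exact: u_smooth 0%N z Iz|exact: v_smooth 0%N z Iz
  |exact: u_smooth 1%N z Iz|exact: v_smooth 1%N z Iz].
Qed.
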